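(* Let $n\ge 2$, $\mathbf k=(k_1,\ldots,k_n)\in\mathbb Z^n$ and $x\in\mathbb Z$. Then there exists a sijection $$\Phi_{\mathbf k,x}\colon\bigsqcup_{\mu\in\underline{\mathrm{AR}}_n}\ \bigsqcup_{\mathbf l\in e(\mathbf k,\mu)}\underline{\mathrm{SGT}}(\mathbf l)\Rightarrow\underline{\mathrm{SGT}}(\mathbf k).$$
   Context: **Signed sets.** A signed set is a pair $\underline S=(S^+,S^-)$ of disjoint finite sets (equivalently, a finite set with a sign function to $\{1,-1\}$); $s\in\underline S$ means $s\in S^+\cup S^-$. The Cartesian product $\underline S\times\underline T$ has underlying set the Cartesian product, with the sign of a tuple the product of the signs of its entries; powers $\underline S^{m}$ are iterated products ($\underline S^0$ is a single positive element). For a family of signed sets $\underline S_t$ indexed by a signed set $\underline T$, the disjoint union $\bigsqcup_{t\in\underline T}\underline S_t$ has elements $(s,t)$ with $t\in\underline T$, $s\in\underline S_t$, with sign equal to the sign of $s$ in $\underline S_t$ times the sign of $t$ in $\underline T$. For $a,b\in\mathbb Z$ the signed interval is $\underline{[a,b]}=([a,b]\cap\mathbb Z,\emptyset)$ if $a\le b$ and $\underline{[a,b]}=(\emptyset,[b+1,a-1]\cap\mathbb Z)$ if $a>b$. **Sijections.** A sijection $\varphi\colon\underline S\Rightarrow\underline T$ is an involution on the ordinary disjoint union $(S^+\cup S^-)\sqcup(T^+\cup T^-)$ with $\varphi(S^+\sqcup T^-)=S^-\sqcup T^+$. **Arrow rows.** Let $U$ denote a third symbol (the double arrow combining $\nwarrow$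 and $\nearrow$). The signed set of arrow rows of order $n$ is $\underline{\mathrm{AR}}_n=(\{\nearrow,\nwarrow\},\{U\})^n$. Let $\delta_{\nwarrow}(\nwarrow)=\delta_{\nwarrow}(U)=\delta_{\nearrow}(\nearrow)=\delta_{\nearrow}(U)=1$ and $\delta_{\nwarrow}(\nearrow)=\delta_{\nearrow}(\nwarrow)=0$. For $\mu=(\mu_1,\ldots,\mu_n)\in\underline{\mathrm{AR}}_n$, $$e(\mathbf k,\mu)=\underline{[k_1+\delta_{\nearrow}(\mu_1),\,k_2-\delta_{\nwarrow}(\mu_2)]}\times\cdots\times\underline{[k_{n-1}+\delta_{\nearrow}(\mu_{n-1}),\,k_n-\delta_{\nwarrow}(\mu_n)]}.$$ **Gelfand-Tsetlin patterns.** For $k\in\mathbb Z$, $\underline{\mathrm{GT}}(k)=(\{\cdot\},\emptyset)$ (one positive element), and recursively for $m\ge2$ $$\underline{\mathrm{GT}}(k_1,\ldots,k_m)=\bigsqcup_{\mathbf l\in\underline{[k_1,k_2]}\times\cdots\times\underline{[k_{m-1},k_m]}}\underline{\mathrm{GT}}(l_1,\ldots,l_{m-1}).$$ **Arrow patterns and shifted Gelfand-Tsetlin patterns.** Let $D$ denote a further symbol (the double arrow combining $\swarrow$ and $\searrow$). The signed set of arrow patterns of order $m$ is $\underline{\mathrm{AP}}_m=(\{\swarrow,\searrow\},\{D\})^{\binom m2}$; its elements are arrays $T=(t_{p,q})_{1\le p<q\le m}$ with entries in $\{\swarrow,\searrow,D\}$ and sign $(-1)^{\#\{(p,q):t_{p,q}=D\}}$.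 Let $\delta_{\swarrow}(\swarrow)=\delta_{\swarrow}(D)=\delta_{\searrow}(\searrow)=\delta_{\searrow}(D)=1$ and $\delta_{\swarrow}(\searrow)=\delta_{\searrow}(\swarrow)=0$, and set $$c_i(T)=\sum_{j=i+1}^m\delta_{\swarrow}(t_{i,j})-\sum_{j=1}^{i-1}\delta_{\searrow}(t_{j,i}),\qquad d(\mathbf k,T)=(k_1+c_1(T),\ldots,k_m+c_m(T)).$$ For $\mathbf k\in\mathbb Z^m$, shifted Gelfand-Tsetlin patterns are $\underline{\mathrm{SGT}}(\mathbf k)=\bigsqcup_{T\in\underline{\mathrm{AP}}_m}\underline{\mathrm{GT}}(d(\mathbf k,T))$. *)

(* Defs.v *)
From HB Require Import structures.
From mathcomp Require Import all_boot all_order all_algebra.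
From mathcomp Require Import zify.

Set Implicit Arguments.
Unset Strict Implicit.
Unset Printing Implicit Defensive.

Import Order.TTheory GRing.Theory Num.Theory.
Local Open Scope ring_scope.

(** A signed set is a finite type with a sign function; signs are booleans,
    [true] being the sign -1, so that the product of signs is [addb]. *)

Record signedSet := SignedSet {
  carrier :> finType;
  neg : carrier -> bool
}.
Arguments neg {s} _.

Definition spoint : signedSet := @SignedSet unit (fun=> false).

Definition sprod (I : finType) (S : I -> signedSet) : signedSet :=
  @SignedSet {dffun forall i : I, S i}
    (fun f => \big[addb/false]_(i : I) neg (f i)).

Definition spow (S : signedSet) (I : finType) : signedSet :=
  sprod (fun _ : I => S).

Definition sunion (T : signedSet) (S : T -> signedSet) : signedSet :=
  @SignedSet {t : T & S t} (fun u => neg (tagged u) (+) neg (tag u)).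

Definition sint_elts (a b : int) : seq int :=
  if a <= b then [seq a + i%:Z | i <- iota 0 `|(b - a + 1)%R|%N]
  else [seq b + 1 + i%:Z | i <- iota 0 `|(a - 1 - b)%R|%N].

Lemma mem_sint_elts (a b x : int) :
  (x \in sint_elts a b) =
  if a <= b then a <= x <= b else b + 1 <= x <= a - 1.
Proof.
have mem_run (c : int) (n : nat) :
    (x \in [seq c + i%:Z | i <- iota 0 n]) = (c <= x < c + n%:Z).
  apply/mapP/idP => [[i]|/andP[cx xn]].
    by rewrite mem_iota add0n => /andP[_ i_n] ->; rewrite lerDl ltrD2l.
  exists `|(x - c)%R|%N; last by rewrite gez0_abs ?subr_ge0 // addrC subrK.
  by rewrite mem_iota /= add0n -ltz_nat gez0_abs ?subr_ge0 // ltrBlDl.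
rewrite /sint_elts; case: (leP a b) => ab; rewrite mem_run gez0_abs; lia.
Qed.

(** The carrier consists of the integers in [sint_elts a b]; it is empty when
    [a = b + 1]. *)
Definition sint (a b : int) : signedSet :=
  @SignedSet (seq_sub (sint_elts a b)) (fun=> b < a).

(** The product of the signed intervals from [lo i] to [hi (i + 1)], for
    [i < m]. *)
Definition sbox (m : nat) (lo hi : 'I_m.+1 -> int) : signedSet :=
  sprod (fun i : 'I_m =>
    sint (lo (widen_ord (leqnSn m) i)) (hi (lift ord0 i))).

Definition is_sijection (S T : signedSet) (phi : S + T -> S + T) : Prop :=
  involutive phi /\
  phi @: [set u | match u with inl s => ~~ neg s | inr t => neg t end] =
         [set u | match u with inl s => neg s | inr t => ~~ neg t end].

Definition sbox_val (m : nat) (lo hi : 'I_m.+1 -> int) (l : sbox lo hi)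
  (i : 'I_m) : int := ssval (l i).

(** Patterns whose bottom row is [k], of positive length [m.+1]. *)
Fixpoint GT (m : nat) : ('I_m.+1 -> int) -> signedSet :=
  match m with
  | 0 => fun=> spoint
  | _.+1 => fun k => sunion (fun l : sbox k k => GT (sbox_val l))
  end.

(** [UBoth] is the double arrow combining [NW] and [NE]. *)
Inductive uarrow := NW | NE | UBoth.

(** [DBoth] is the double arrow combining [SW] and [SE]. *)
Inductive darrow := SW | SE | DBoth.

Definition uarrow_code (a : uarrow) : option bool :=
  match a with NW => Some true | NE => Some false | UBoth => None end.
Definition uarrow_decode (c : option bool) : uarrow :=
  match c with Some true => NW | Some false => NE | None => UBoth end.
Lemma uarrow_codeK : cancel uarrow_code uarrow_decode.
Proof. by case. Qed.
HB.instance Definition _ := Finite.copy uarrow (can_type uarrow_codeK).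

Definition darrow_code (a : darrow) : option bool :=
  match a with SW => Some true | SE => Some false | DBoth => None end.
Definition darrow_decode (c : option bool) : darrow :=
  match c with Some true => SW | Some false => SE | None => DBoth end.
Lemma darrow_codeK : cancel darrow_code darrow_decode.
Proof. by case. Qed.
HB.instance Definition _ := Finite.copy darrow (can_type darrow_codeK).

Definition suarrow : signedSet :=
  @SignedSet uarrow (fun a => if a is UBoth then true else false).
Definition sdarrow : signedSet :=
  @SignedSet darrow (fun a => if a is DBoth then true else false).

Definition deltaNW (a : uarrow) : int := if a is NE then 0 else 1.
Definition deltaNE (a : uarrow) : int := if a is NW then 0 else 1.
Definition deltaSW (a : darrow) : int := if a is SE then 0 else 1.
Definition deltaSE (a : darrow) : int := if a is SW then 0 else 1.

Definition AR (n : nat) : signedSet := spow suarrow 'I_n.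

Definition e_box (n : nat) (k : 'I_n.+1 -> int) (mu : AR n.+1) : signedSet :=
  sbox (fun i => k i + deltaNE (mu i)) (fun i => k i - deltaNW (mu i)).

Definition ord_pair (m : nat) : finType :=
  {p : 'I_m * 'I_m | (p.1 < p.2)%N}.

Definition AP (m : nat) : signedSet := spow sdarrow (ord_pair m).

Definition c_shift (m : nat) (T : AP m) (i : 'I_m) : int :=
  \sum_(p : ord_pair m | (val p).1 == i) deltaSW (T p)
  - \sum_(p : ord_pair m | (val p).2 == i) deltaSE (T p).

Definition d_shift (m : nat) (k : 'I_m -> int) (T : AP m) (i : 'I_m) : int :=
  k i + c_shift T i.

Definition SGT (m : nat) (k : 'I_m.+1 -> int) : signedSet :=
  sunion (fun T : AP m.+1 => GT (d_shift k T)).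

(* Main.v *)
Require Import Defs.
From mathcomp Require Import all_boot all_order all_algebra all_fingroup.
From mathcomp Require Import zify ring.
From Stdlib Require Import FunctionalExtensionality.

Set Implicit Arguments.
Unset Strict Implicit.
Unset Printing Implicit Defensive.

Import Order.TTheory GRing.Theory Num.Theory.
Local Open Scope ring_scope.

(** A sijection between two signed sets exists exactly when their signed
    cardinals agree, so the theorem is an identity between integers: the number
    of shifted Gelfand-Tsetlin patterns satisfies the recursion of monotone
    triangles.

    In the strict coordinates [x i = k i + i], the signed count of
    Gelfand-Tsetlin patterns is the determinant of the [b_j (x i)], where
    [b_0 = 1] and [b_(j+1)] is a discrete primitive of [b_j] ([scard_GT]).
    Counting shifted patterns applies to this determinant, for every pair
    [p < q], the operator [E_p + E_q^-1 - E_p E_q^-1], where [E_p] translates the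
    coordinate [p] by one ([scard_SGT]).  These operators commute.

    On the right-hand side, expand the determinant along its constant column
    [b_0].  The term without the coordinate [i] does not see the translations of
    [x i], so the operators of the pairs containing [i] act as the identity on it,
    and the remaining ones act as in one dimension less
    ([steps_gtdet_expand]).

    On the left-hand side, summing over a box replaces each [b_j] by
    [b_(j+1)] and produces an alternating sum over the choices, for each interval,
    of its upper or its lower end ([sum_sbox_steps]).  Suppose first that some
    interval is evaluated at its upper end and the next one at its lower end.
    Both coordinates then sit at the same entry of [x], and the arrow of that
    entry together with the operator of this pair of coordinates gives nine
    translations that form, with their signs, a symmetric family, while what they
    act on is antisymmetric; so the contribution is zero ([step_row_pair],
    [steps_row_adjacent]).  In the choices that are left, lower ends come before
    upper ends; each entry of [x] is then used at most once, its arrow has no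
    effect ([steps_row_threshold]), and exactly one entry is not used.  These are
    the terms of the expansion of the right-hand side. *)

(** * Sijections and signed cardinals *)

Definition scard (S : signedSet) : int := \sum_(s : S) (-1) ^+ neg s.

Lemma involution_onto_setC (U : finType) (A : {set U}) :
  #|A| = #|~: A| -> exists phi, involutive phi /\ phi @: A = ~: A.
Proof.
move=> cardA.
(* Match the two enumerations rank by rank. *)
pose phi u := if u \in A then nth u (enum (~: A)) (index u (enum A))
              else nth u (enum A) (index u (enum (~: A))).
have lt_in u : u \in A -> (index u (enum A) < size (enum (~: A)))%N.
  by move=> uA; rewrite -cardE -cardA cardE index_mem mem_enum.
have lt_out u : u \notin A -> (index u (enum (~: A)) < size (enum A))%N.
  by move=> uA; rewrite -cardE cardA cardE index_mem mem_enum in_setC.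
have phi_in u : u \in A -> phi u \in ~: A.
  by move=> uA; rewrite /phi uA -mem_enum mem_nth ?lt_in.
have phi_out u : u \notin A -> phi u \in A.
  by move=> uA; rewrite /phi (negbTE uA) -mem_enum mem_nth ?lt_out.
have phiK : involutive phi.
  move=> u; have [uA|uA] := boolP (u \in A).
    have := phi_in _ uA; rewrite inE {2}/phi => /negbTE ->.
    by rewrite /phi uA index_uniq ?enum_uniq ?lt_in // nth_index ?mem_enum.
  rewrite {1}/phi phi_out // /phi (negbTE uA).
  by rewrite index_uniq ?enum_uniq ?lt_out // nth_index // mem_enum in_setC.
exists phi; split=> //; apply/setP=> u; apply/imsetP/idP.
  by case=> w wA ->; apply: phi_in.
by rewrite inE => uA; exists (phi u); [apply: phi_out | rewrite phiK].
Qed.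

Lemma scardE (S : signedSet) :
  scard S = #|[set s : S | ~~ neg s]|%:Z - #|[set s : S | neg s]|%:Z.
Proof.
rewrite /scard (bigID (fun s : S => neg s)) /= addrC !cardsE -!sum1_card.
rewrite -!natz !natr_sum -sumrN.
by congr (_ + _); apply: eq_bigr => s; [move=> /negbTE -> | move=> ->].
Qed.

Lemma card_set_sum (S T : finType) (a : pred S) (b : pred T) :
  #|[set u : S + T | match u with inl s => a s | inr t => b t end]|
  = (#|[set s | a s]| + #|[set t | b t]|)%N.
Proof.
rewrite -!sum1_card big_mkcond big_sumType -!big_mkcond /=.
by congr (_ + _)%N; apply: eq_bigl => s; rewrite !inE.
Qed.

(** The sign condition on a sijection says that it exchanges a subset of the
    disjoint union with its complement. *)
Lemma sijection_of_scard (S T : signedSet) :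
  scard S = scard T -> exists phi, @is_sijection S T phi.
Proof.
move=> eqST; pose A : {set S + T} :=
  [set u | match u with inl s => ~~ neg s | inr t => neg t end].
have AC : ~: A = [set u | match u with inl s => neg s | inr t => ~~ neg t end].
  by apply/setP=> -[s|t]; rewrite !inE ?negbK.
have [|phi [phiK phiA]] := @involution_onto_setC _ A; last first.
  by exists phi; split; rewrite // -AC.
by rewrite AC !card_set_sum; move: eqST; rewrite !scardE; lia.
Qed.

Lemma scard_sunion (T : signedSet) (S : T -> signedSet) :
  scard (sunion S) = \sum_(t : T) (-1) ^+ neg t * scard (S t).
Proof.
rewrite /scard; under [RHS]eq_bigr do rewrite mulr_sumr.
by rewrite sig_big_dep; apply: eq_bigr => -[t s] _; rewrite /= signr_addb mulrC.
Qed.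

Lemma sum_dffun_prod (I : finType) (J : I -> finType) (F : forall i, J i -> int) :
  \sum_(f : {dffun forall i, J i}) \prod_i F i (f i) = \prod_i \sum_(j : J i) F i j.
Proof.
rewrite (reindex (@dffun_of_fprod _ _)) /=; last first.
  exact/onW_bij/dffun_of_fprod_bij.
pose G i := [ffun j : J i => F i j].
transitivity (\sum_(f : fprod J) \prod_(i in I) G i (f i)).
  by apply: eq_bigr => f _; apply: eq_bigr => i _; rewrite !ffunE.
rewrite big_fprod; transitivity (\prod_i \sum_(j : J i) G i j).
  under [RHS]eq_bigr do rewrite (big_tag (fun i => G i)).
  by rewrite bigA_distr_big_dep.
by apply: eq_bigr => i _; apply: eq_bigr => j _; rewrite ffunE.
Qed.

Lemma neg_sprod (I : finType) (S : I -> signedSet) (f : sprod S) :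
  (-1) ^+ neg f = \prod_i (-1) ^+ neg (f i) :> int.
Proof.
rewrite /=; apply: (big_ind2 (fun (b : bool) (z : int) => (-1) ^+ b = z)) => //.
by move=> b1 z1 b2 z2 <- <-; rewrite signr_addb.
Qed.

(** * Signed sums over intervals and boxes *)

(** The primitive of [f] for the forward difference that vanishes at [0]; at a
    negative [x] it is minus the sum of the values of [f] from [x] to [-1]. *)
Definition prim (f : int -> int) (x : int) : int :=
  match x with
  | Posz n => \sum_(i < n) f i
  | Negz n => - \sum_(i < n.+1) f (Negz i)
  end.

Lemma primS f x : prim f (x + 1) = prim f x + f x.
Proof.
case: x => n.
  have -> : Posz n + 1 = n.+1 by lia.
  by rewrite /prim big_ord_recr.
case: n => [|n].
  have -> : Negz 0 + 1 = Posz 0 by [].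
  by rewrite /prim big_ord0 big_ord1; ring.
have -> : Negz n.+1 + 1 = Negz n by lia.
by rewrite /prim [in RHS]big_ord_recr /=; ring.
Qed.

Lemma sum_prim f a n :
  \sum_(i <- iota 0 n) f (a + i%:Z) = prim f (a + n%:Z) - prim f a.
Proof.
elim: n => [|n IHn]; first by rewrite big_nil addr0 subrr.
rewrite -addn1 iotaD big_cat /= big_seq1 IHn add0n PoszD addrA primS; ring.
Qed.

(** The sign convention for [a > b] is what makes telescoping valid for all
    [a] and [b].  The translation [z] absorbs the passage to strict coordinates
    and the shifts by arrows. *)
Lemma sum_sint f a b z :
  \sum_(y : sint a b) (-1) ^+ neg y * f (ssval y + z)
  = prim f (b + 1 + z) - prim f (a + z).
Proof.
have sumE (g : int -> int) :
    \sum_(y : sint a b) g (ssval y) = \sum_(y <- sint_elts a b) g y.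
  have uniq_s : uniq (sint_elts a b).
    rewrite /sint_elts; case: ifP => _;
    by rewrite map_inj_uniq ?iota_uniq // => i j; lia.
  transitivity (\sum_(y <- map val (enum {: seq_sub (sint_elts a b)})) g y).
    by rewrite big_map big_enum.
  apply/perm_big/uniq_perm => //.
    by rewrite map_inj_uniq ?enum_uniq //; apply: val_inj.
  move=> y; apply/mapP/idP => [[w _ ->]|ys]; first exact: ssvalP.
  by exists (SeqSub ys); rewrite ?mem_enum.
have run_prim (c : int) n :
    \sum_(i <- iota 0 n) f (c + i%:Z + z) = prim f (c + z + n%:Z) - prim f (c + z).
  by rewrite -sum_prim; apply: eq_bigr => i _; congr f; ring.
rewrite /= -mulr_sumr (sumE (fun y => f (y + z))) /sint_elts ltNge.
case: leP => ab /=.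
  by rewrite big_map run_prim mul1r; congr (prim _ _ - _); lia.
by rewrite big_map run_prim mulN1r opprB; congr (prim _ _ - prim _ _); lia.
Qed.

(** The polynomial [x (x - 1) ... (x - j + 1) / j!], at any integer [x]. *)
Definition binz (j : nat) : int -> int := iter j prim (fun=> 1).

Notation vec n := {ffun 'I_n -> int}.

(** For [s = 0] this counts patterns; taking the forward difference of the case
    [s = 1] once in each coordinate gives the case [s = 0]. *)
Definition gtdet (s n : nat) (x : vec n) : int :=
  \det (\matrix_(i < n, j < n) binz (s + j) (x i)).
Arguments gtdet s {n} x.

Definition pull (n m : nat) (h : 'I_n -> 'I_m) (x : vec m) : vec n :=
  [ffun j => x (h j)].

Lemma gtdet_tperm s n (i j : 'I_n) (x : vec n) :
  i != j -> gtdet s (pull (tperm i j) x) = - gtdet s x.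
Proof.
move=> nij; rewrite /gtdet.
have -> : \matrix_(a, b) binz (s + b) (pull (tperm i j) x a) =
    xrow i j (\matrix_(a, b) binz (s + b) (x a)) :> 'M_n.
  by apply/matrixP=> a b; rewrite !mxE ffunE.
by rewrite xrowE det_mulmx det_perm odd_tperm nij mulN1r.
Qed.

Lemma gtdet_eq0 s n (i j : 'I_n) (x : vec n) :
  i != j -> x i = x j -> gtdet s x = 0.
Proof.
move=> nij xij; apply: (determinant_alternate nij) => a.
by rewrite !mxE xij.
Qed.

(** A choice [c] evaluates the interval [j] at its upper end if [c j], and
    otherwise at its lower end, with sign -1. *)
Definition choice_sign (m : nat) (c : {ffun 'I_m -> bool}) : int :=
  \prod_j (-1) ^+ (~~ c j).

(** In each term of the Leibniz formula the sum over the box factors into sums over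
    intervals; expanding the product of the differences of primitives gives the
    sum over [c]. *)
Lemma sum_sbox_gtdet m (lo hi : 'I_m.+1 -> int) (z : vec m) :
  \sum_(l : sbox lo hi) (-1) ^+ neg l * gtdet 0 (finfun (sbox_val l) + z)
  = \sum_(c : {ffun 'I_m -> bool}) choice_sign c *
      gtdet 1 ([ffun j => if c j then hi (lift ord0 j) + 1
                          else lo (widen_ord (leqnSn m) j)] + z).
Proof.
rewrite /gtdet /determinant.
under eq_bigr do rewrite mulr_sumr.
under [RHS]eq_bigr do rewrite mulr_sumr.
rewrite exchange_big [RHS]exchange_big; apply: eq_bigr => s _.
pose F (i : 'I_m) (y : sint (lo (widen_ord (leqnSn m) i)) (hi (lift ord0 i))) :=
  (-1) ^+ neg y * binz (s i) (ssval y + z i).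
pose G (i : 'I_m) (b : bool) := (-1) ^+ (~~ b) *
  binz (1 + s i) ((if b then hi (lift ord0 i) + 1
                  else lo (widen_ord (leqnSn m) i)) + z i).
transitivity ((-1) ^+ s * \sum_(l : sbox lo hi) \prod_i F i (l i)).
  rewrite mulr_sumr; apply: eq_bigr => l _.
  rewrite [(-1) ^+ neg l]neg_sprod mulrCA -big_split; congr (_ * _).
  by apply: eq_bigr => i _; rewrite !mxE !ffunE.
transitivity ((-1) ^+ s * \sum_(c : {ffun 'I_m -> bool}) \prod_i G i (c i)).
  rewrite sum_dffun_prod -bigA_distr_bigA; congr (_ * _).
  apply: eq_bigr => i _; rewrite sum_sint big_bool /G /=; ring.
rewrite mulr_sumr; apply: eq_bigr => c _.
rewrite /choice_sign mulrCA -big_split /=; congr (_ * _).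
by apply: eq_bigr => i _; rewrite !mxE !ffunE.
Qed.

(** * Choices of ends that survive *)

(** Lower ends for the intervals before [i], upper ends from [i] on. *)
Definition threshold (m : nat) (i : 'I_m.+1) : {ffun 'I_m -> bool} :=
  [ffun j : 'I_m => (i <= j)%N].

Lemma threshold_inj m : injective (@threshold m).
Proof.
suff lt (i j : 'I_m.+1) : (i < j)%N -> @threshold m i != threshold j.
  move=> i j eq_ij; apply: val_inj; case: (ltngtP i j) => // /lt /eqP.
    by case.
  by case.
move=> ij; have im : (i < m)%N by have := ltn_ord j; lia.
apply/eqP => /ffunP /(_ (Ordinal im)); rewrite !ffunE /=.
by rewrite leqnn leqNgt ij.
Qed.

Lemma choice_sign_threshold m i : choice_sign (@threshold m i) = (-1) ^+ i.
Proof.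
rewrite /choice_sign.
transitivity (\prod_(j < m) (if (j < i)%N then -1 else 1 : int)).
  by apply: eq_bigr => j _; rewrite ffunE -ltnNge; case: ltnP.
rewrite -big_mkcond /= prodr_const; congr (_ ^+ _).
rewrite -sum1_card -(big_ord_widen m (fun=> 1%N)); last by rewrite -ltnS ltn_ord.
by rewrite sum1_card card_ord.
Qed.

Lemma monotone_threshold m (c : {ffun 'I_m -> bool}) :
  (forall j1 j2 : 'I_m, j2 = j1.+1 :> nat -> c j1 -> c j2) ->
  exists i, c = threshold i.
Proof.
move=> cS.
have mono : forall d (j1 j2 : 'I_m), (j2 = j1 + d :> nat)%N -> c j1 -> c j2.
  elim=> [|d IHd] j1 j2 e c1.
    by rewrite (_ : j2 = j1) //; apply: val_inj; rewrite /= e addn0.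
  have lt : (j1 + d < m)%N by have := ltn_ord j2; lia.
  by apply: (cS (Ordinal lt)); [rewrite e /= addnS | apply: (IHd j1)].
have [j0 c0|c0] := pickP c; last first.
  exists ord_max; apply/ffunP => j; rewrite ffunE c0 /=.
  by rewrite leqNgt ltn_ord.
case: (arg_minnP (fun j : 'I_m => val j) c0) => i ci mini.
exists (widen_ord (leqnSn m) i); apply/ffunP => j; rewrite ffunE /=.
apply/idP/idP => [/mini //|ij]; apply: (mono (j - i)%N i) => //; lia.
Qed.

(** A choice that is not a threshold has an upper end followed by a lower end. *)
Lemma sum_threshold m (H : {ffun 'I_m -> bool} -> int) :
  (forall (c : {ffun 'I_m -> bool}) (j1 j2 : 'I_m), j2 = j1.+1 :> nat ->
     c j1 -> ~~ c j2 -> H c = 0) ->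
  \sum_c H c = \sum_(i < m.+1) H (threshold i).
Proof.
move=> H0; rewrite (bigID (mem [set threshold i | i : 'I_m.+1])) /=.
rewrite big_imset /=; last by move=> i j _ _; apply: threshold_inj.
rewrite [X in _ + X]big1 ?addr0 // => c nc.
apply/eqP/negPn/negP => Hc; case/negP: nc.
have [|i ->] := @monotone_threshold _ c; last exact: imset_f.
move=> j1 j2 e c1; apply/negPn/negP => c2.
by rewrite (H0 c j1 j2) ?eqxx in Hc.
Qed.

(** * Gelfand-Tsetlin patterns *)

Definition endpoints (m : nat) (c : {ffun 'I_m -> bool}) (x : vec m.+1) : vec m :=
  [ffun j => x (if c j then lift ord0 j else widen_ord (leqnSn m) j)].

(** The [i] lower ends are the entries before [i], and the upper ends those
    after [i]. *)
Lemma endpoints_threshold m i (x : vec m.+1) :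
  endpoints (threshold i) x = pull (lift i) x.
Proof.
apply/ffunP=> j; rewrite !ffunE; congr (x _); apply: val_inj.
by rewrite /= /bump; case: ifP.
Qed.

Lemma gtdet_expand m (x : vec m.+1) :
  gtdet 0 x = \sum_(i < m.+1) (-1) ^+ i * gtdet 1 (pull (lift i) x).
Proof.
rewrite /gtdet (expand_det_col _ ord0); apply: eq_bigr => i _.
rewrite !mxE mul1r /cofactor addn0; congr (_ * \det _).
by apply/matrixP=> a b; rewrite !mxE ffunE.
Qed.

(** In these coordinates the interval from [k i] to [k (i + 1)] has its primitives
    evaluated at the entries themselves, and the count is antisymmetric. *)
Definition strict (m : nat) (k : 'I_m -> int) : vec m := [ffun i => k i + i%:Z].

(** When an upper end is followed by a lower end, the two coordinates coincide and
    the determinant vanishes; the thresholds give the Laplace expansion. *)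
Lemma scard_GT m (k : 'I_m.+1 -> int) : scard (GT k) = gtdet 0 (strict k).
Proof.
elim: m k => [|m IHm] k.
  rewrite /scard /gtdet (eq_bigr (fun=> 1)) // sumr_const det_mx11 mxE.
  by rewrite card_unit.
rewrite scard_sunion.
pose z := [ffun j : 'I_m.+1 => j%:Z].
transitivity (\sum_(l : sbox k k) (-1) ^+ neg l * gtdet 0 (finfun (sbox_val l) + z)).
  apply: eq_bigr => l _; rewrite IHm; congr (_ * gtdet _ _).
  by apply/ffunP => j; rewrite !ffunE.
rewrite sum_sbox_gtdet gtdet_expand.
transitivity (\sum_c choice_sign c * gtdet 1 (endpoints c (strict k))).
  apply: eq_bigr => c _; congr (_ * gtdet _ _); apply/ffunP => j; rewrite !ffunE.
  by case: ifP => _ //; rewrite lift0 -addrA; congr (_ + _); lia.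
rewrite sum_threshold => [|c j1 j2 e c1 /negbTE c2]; last first.
  rewrite (@gtdet_eq0 _ _ j1 j2) ?mulr0 //; first by rewrite -val_eqE /= e; lia.
  by rewrite !ffunE c1 c2 (_ : lift _ _ = widen_ord (leqnSn _) j2) //; apply: val_inj.
by apply: eq_bigr => i _; rewrite choice_sign_threshold endpoints_threshold.
Qed.

(** * Sums over arrows as compositions of shift operators *)

Definition step (A : signedSet) (W : zmodType) (v : A -> W) (f : W -> int) (y : W) :
    int :=
  \sum_(a : A) (-1) ^+ neg a * f (y + v a).

(** The operators are composed over a sequence rather than a finite type, so that
    the factors can be reordered and split. *)
Definition steps (A : signedSet) (W : zmodType) (I : Type) (v : I -> A -> W)
  (s : seq I) (f : W -> int) : W -> int := foldr (fun i => step (v i)) f s.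

(** Arrays with entries outside [s] frozen to [a0] make an induction on [s]
    possible. *)
Lemma sum_spow_supported (A : signedSet) (W : zmodType) (I : finType)
    (v : I -> A -> W) (f : W -> int) (a0 : A) (s : seq I) (y : W) : uniq s ->
  \sum_(T : spow A I | [forall i, (i \notin s) ==> (T i == a0)])
     (\prod_(i <- s) (-1) ^+ neg (T i)) * f (y + \sum_(i <- s) v i (T i))
  = steps v s f y.
Proof.
elim: s y => [|i s IHs] y /=.
  move=> _; rewrite (big_pred1 ([ffun=> a0] : spow A I)).
    by rewrite !big_nil mul1r addr0.
  move=> T; apply/forallP/eqP => [T0|-> i]; last by rewrite ffunE.
  by apply/ffunP => i; rewrite ffunE; have /eqP := T0 i.
case/andP => nis us.
rewrite (partition_big (fun T : spow A I => T i) predT) //=.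
rewrite /step; apply: eq_bigr => a _.
pose upd (b : A) (T : spow A I) : spow A I :=
  [ffun j => if j == i then b else T j].
rewrite (reindex_onto (upd a) (upd a0)) /=; last first.
  move=> T /andP[_ /eqP Ti]; apply/ffunP => j; rewrite !ffunE.
  by case: eqP => // ->.
rewrite -IHs // mulr_sumr; apply: eq_big => [T|T _].
  apply/andP/forallP => [[/andP[/forallP T0 _] /eqP eT] j|T0].
    apply/implyP => js; have := T0 j; rewrite in_cons negb_or js !ffunE.
    by case: eqP => [-> _|_ //]; rewrite -eT !ffunE eqxx.
  rewrite !ffunE eqxx eqxx; split.
    rewrite andbT; apply/forallP => j; apply/implyP; rewrite in_cons negb_or.
    by rewrite ffunE => /andP[/negbTE -> js]; have := T0 j; rewrite js.
  apply/eqP/ffunP => j; rewrite !ffunE; case: eqP => // ->.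
  by have := T0 i; rewrite nis => /eqP.
have ne j : j \in s -> (j == i) = false.
  by move=> js; apply/negbTE; apply: contraNneq nis => <-.
rewrite !big_cons !ffunE eqxx -mulrA addrA; congr (_ * (_ * f (_ + _))).
  by apply: eq_big_seq => j /ne ji; rewrite ffunE ji.
by apply: eq_big_seq => j /ne ji; rewrite ffunE ji.
Qed.

(** Arrow rows and arrow patterns act on functions through this identity: a sum
    over arrays of arrows is the composition of one operator for each entry. *)
Lemma sum_spow_steps (A : signedSet) (W : zmodType) (I : finType)
    (v : I -> A -> W) (f : W -> int) (a0 : A) (y : W) :
  \sum_(T : spow A I) (-1) ^+ neg T * f (y + \sum_i v i (T i))
  = steps v (enum I) f y.
Proof.
rewrite -(sum_spow_supported _ _ a0) ?enum_uniq //; apply: eq_big => [T|T _].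
  by apply/esym/forallP => i; rewrite mem_enum.
by rewrite neg_sprod !big_enum.
Qed.

Lemma stepC (A B : signedSet) (W : zmodType) (v : A -> W) (w : B -> W) f :
  step v (step w f) = step w (step v f).
Proof.
apply: functional_extensionality => y; rewrite /step.
under eq_bigr do rewrite mulr_sumr.
under [RHS]eq_bigr do rewrite mulr_sumr.
rewrite exchange_big; apply: eq_bigr => b _; apply: eq_bigr => a _.
by rewrite mulrCA addrAC.
Qed.

Section Steps.
Variables (A : signedSet) (W : zmodType) (I : eqType) (v : I -> A -> W).
Implicit Types (f : W -> int) (s t : seq I).

Lemma steps_cat s t f : steps v (s ++ t) f = steps v s (steps v t f).
Proof. exact: foldr_cat. Qed.

Lemma step_steps (B : signedSet) (w : B -> W) s f :
  step w (steps v s f) = steps v s (step w f).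
Proof. by elim: s => //= i s IHs; rewrite stepC IHs. Qed.

Lemma stepsC s t f : steps v s (steps v t f) = steps v t (steps v s f).
Proof. by elim: s => //= i s ->; apply: step_steps. Qed.

Lemma perm_steps s t f : perm_eq s t -> steps v s f = steps v t f.
Proof.
move=> st; move: s t st (erefl (steps v s f)).
suff H s t : perm_eq s t -> forall g, g = steps v s f -> g = steps v t f.
  by move=> s t st _; apply: (H s t).
move=> st g; move: s t st; apply: catCA_perm_ind => s1 s2 s3 ->.
by rewrite !steps_cat stepsC.
Qed.

Lemma steps_sum (J : Type) (r : seq J) (a : J -> int) (f : J -> W -> int) s y :
  steps v s (fun z => \sum_(j <- r) a j * f j z) y
  = \sum_(j <- r) a j * steps v s (f j) y.
Proof.
elim: s y => //= i s IHs y; rewrite /step.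
transitivity (\sum_(b : A) \sum_(j <- r)
    (-1) ^+ neg b * (a j * steps v s (f j) (y + v i b))).
  by apply: eq_bigr => b _; rewrite IHs mulr_sumr.
rewrite exchange_big; apply: eq_bigr => j _.
by rewrite mulr_sumr; apply: eq_bigr => b _; rewrite mulrCA.
Qed.

Lemma stepsN f s y : steps v s (fun z => - f z) y = - steps v s f y.
Proof.
elim: s y => //= i s IHs y; rewrite /step -sumrN.
by apply: eq_bigr => b _; rewrite IHs mulrN.
Qed.

Lemma steps_vanish (D : W -> Prop) f s :
    (forall i a y, i \in s -> D y -> D (y + v i a)) ->
    (forall y, D y -> f y = 0) ->
  forall y, D y -> steps v s f y = 0.
Proof.
move=> DS f0; elim: s DS => //= i s IHs DS y Dy.
rewrite /step big1 // => a _; rewrite IHs ?mulr0 //.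
  by move=> j b z js; apply: DS; rewrite in_cons js orbT.
by apply: DS; rewrite ?mem_head.
Qed.

Lemma steps_id s f :
  (forall i, i \in s -> step (v i) f = f) -> steps v s f = f.
Proof.
elim: s => //= i s IHs sf; rewrite IHs; first by apply: sf; rewrite mem_head.
by move=> j js; apply: sf; rewrite in_cons js orbT.
Qed.
End Steps.

Lemma steps_map (A : signedSet) (W : zmodType) (I J : Type) (h : J -> I)
    (v : I -> A -> W) (s : seq J) (f : W -> int) :
  steps v (map h s) f = steps (v \o h) s f.
Proof. by elim: s => //= j s ->. Qed.

(** * The operators of arrow patterns *)

Lemma sum_sdarrow (F : sdarrow -> int) :
  \sum_(a : sdarrow) F a = F SW + F SE + F DBoth.
Proof.
rewrite (bigD1 (SW : sdarrow)) // (bigD1 (SE : sdarrow)) //=.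
rewrite (bigD1 (DBoth : sdarrow)) //= big1 ?addr0 ?addrA //.
by case.
Qed.

Lemma sum_suarrow (F : suarrow -> int) :
  \sum_(a : suarrow) F a = F NW + F NE + F UBoth.
Proof.
rewrite (bigD1 (NW : suarrow)) // (bigD1 (NE : suarrow)) //=.
rewrite (bigD1 (UBoth : suarrow)) //= big1 ?addr0 ?addrA //.
by case.
Qed.

(** [step (pair_shift (p, q))] is the operator [E_p + E_q^-1 - E_p E_q^-1]. *)
Definition pair_shift n (p : 'I_n * 'I_n) (a : sdarrow) : vec n :=
  [ffun j => (j == p.1)%:R * deltaSW a - (j == p.2)%:R * deltaSE a].

Definition pairs n : seq ('I_n * 'I_n) := [seq val p | p <- enum (ord_pair n)].

Lemma mem_pairs n p : (p \in pairs n) = (p.1 < p.2)%N.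
Proof.
apply/mapP/idP => [[q _ ->]|lt_p]; first exact: (valP q).
by exists (exist _ p lt_p); rewrite ?mem_enum.
Qed.

Lemma uniq_pairs n : uniq (pairs n).
Proof. by rewrite map_inj_uniq ?enum_uniq //; apply: val_inj. Qed.

Lemma scard_SGT m (k : 'I_m.+1 -> int) :
  scard (SGT k) = steps (@pair_shift m.+1) (pairs m.+1) (gtdet 0) (strict k).
Proof.
rewrite steps_map scard_sunion -(sum_spow_steps _ _ (SW : sdarrow)).
apply: eq_bigr => T _; rewrite scard_GT; congr (_ * gtdet _ _).
apply/ffunP => j; rewrite !ffunE sum_ffunE /d_shift /c_shift addrAC.
congr (_ + _); rewrite [in LHS]big_mkcond [X in _ - X]big_mkcond -sumrB.
apply: eq_bigr => p _; rewrite ffunE /= ![_ == j]eq_sym.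
by do 2!case: eqP => _; rewrite ?mul1r ?mul0r.
Qed.

Lemma step_pull n m (h : 'I_n -> 'I_m) p f : injective h ->
  step (pair_shift (h p.1, h p.2)) (f \o pull h)
  = step (@pair_shift n p) f \o pull h.
Proof.
move=> h_inj; apply: functional_extensionality => y; rewrite /step /=.
apply: eq_bigr => a _; congr (_ * f _).
by apply/ffunP => j; rewrite !ffunE !(inj_eq h_inj).
Qed.

Lemma steps_pull n m (h : 'I_n -> 'I_m) s f : injective h ->
  steps (@pair_shift m) [seq (h p.1, h p.2) | p <- s] (f \o pull h)
  = steps (@pair_shift n) s f \o pull h.
Proof. by move=> h_inj; elim: s => //= p s ->; apply: step_pull. Qed.

(** If one of the two coordinates is ignored, the operator becomes
    [1 + E_q^-1 - E_q^-1] or [E_p + 1 - E_p]. *)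
Lemma step_pull_lift m (i : 'I_m.+1) (p : 'I_m.+1 * 'I_m.+1) f :
  (p.1 == i) || (p.2 == i) ->
  step (pair_shift p) (f \o pull (lift i)) = f \o pull (lift i).
Proof.
move=> pi; apply: functional_extensionality => y; rewrite /step sum_sdarrow /=.
have lift_i j : (lift i j == i) = false by apply/negbTE; rewrite eq_sym neq_lift.
rewrite expr0 expr1 !mul1r mulN1r.
have [/eqP p1|p1] := boolP (p.1 == i).
  have -> : pull (lift i) (y + pair_shift p SW) = pull (lift i) y.
    by apply/ffunP => j; rewrite !ffunE p1 lift_i /=; ring.
  have -> : pull (lift i) (y + pair_shift p DBoth)
      = pull (lift i) (y + pair_shift p SE).
    by apply/ffunP => j; rewrite !ffunE p1 lift_i /=; ring.
  by ring.
move: pi; rewrite (negbTE p1) /= => /eqP p2.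
have -> : pull (lift i) (y + pair_shift p SE) = pull (lift i) y.
  by apply/ffunP => j; rewrite !ffunE p2 lift_i /=; ring.
have -> : pull (lift i) (y + pair_shift p DBoth)
    = pull (lift i) (y + pair_shift p SW).
  by apply/ffunP => j; rewrite !ffunE p2 lift_i /=; ring.
by ring.
Qed.

Lemma perm_pairs_lift m (i : 'I_m.+1) :
  perm_eq (pairs m.+1)
    ([seq p <- pairs m.+1 | (p.1 == i) || (p.2 == i)]
     ++ [seq (lift i p.1, lift i p.2) | p <- pairs m]).
Proof.
have inj2 : injective (fun p : 'I_m * 'I_m => (lift i p.1, lift i p.2)).
  move=> [a b] [c d] /eqP; rewrite xpair_eqE !(inj_eq (@lift_inj _ i)).
  by case/andP=> /= /eqP -> /eqP ->.
have lt2 a b : (lift i a < lift i b)%N = (a < b)%N.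
  by rewrite !ltnNge leq_bump2.
apply: uniq_perm; first exact: uniq_pairs.
  rewrite cat_uniq filter_uniq ?uniq_pairs // map_inj_uniq // uniq_pairs andbT /=.
  apply/hasPn => _ /mapP[p _ ->]; rewrite mem_filter /=.
  by rewrite ![_ == i]eq_sym !(negbTE (neq_lift _ _)).
move=> [a b]; rewrite mem_cat mem_filter !mem_pairs /=.
apply/idP/orP => [ab|[/andP[] //|/mapP[[c d]]]]; last first.
  by rewrite mem_pairs /= => cd [-> ->]; rewrite lt2.
case: (unliftP i a) ab => [c|] -> ab; last by left; rewrite eqxx.
case: (unliftP i b) ab => [d|] -> ab; last by left; rewrite eqxx orbT.
by right; apply/mapP; exists (c, d); rewrite // mem_pairs -lt2.
Qed.

(** Laplace expansion along the constant column: the term without the coordinate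
    [i] is unaffected by the pairs containing [i], and the other pairs correspond
    to those in dimension [m]. *)
Lemma steps_gtdet_expand m (x : vec m.+1) :
  steps (@pair_shift m.+1) (pairs m.+1) (gtdet 0) x
  = \sum_(i < m.+1) (-1) ^+ i *
      steps (@pair_shift m) (pairs m) (gtdet 1) (pull (lift i) x).
Proof.
have -> : @gtdet 0 m.+1 = fun y =>
    \sum_(i < m.+1) (-1) ^+ i * (gtdet 1 \o pull (lift i)) y.
  by apply: functional_extensionality => y; apply: gtdet_expand.
rewrite steps_sum; apply: eq_bigr => i _; congr (_ * _).
rewrite (perm_steps _ _ (perm_pairs_lift i)) steps_cat steps_pull; last first.
  exact: lift_inj.
rewrite steps_id // => p; rewrite mem_filter => /andP[pi _].
exact: step_pull_lift.
Qed.

(** * The operators of arrow rows *)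

(** The effect of the arrow at the entry [p] on the ends selected by [c]: this
    entry is the upper end of the interval [p - 1] and the lower end of the
    interval [p]. *)
Definition row_shift m (c : {ffun 'I_m -> bool}) (p : 'I_m.+1) (a : suarrow) :
    vec m :=
  [ffun j => if c j then - ((lift ord0 j == p)%:R * deltaNW a)
             else (widen_ord (leqnSn m) j == p)%:R * deltaNE a].

Lemma sum_sbox_steps m (lo hi : 'I_m.+1 -> int) s (z : vec m) :
  \sum_(l : sbox lo hi) (-1) ^+ neg l *
     steps (@pair_shift m) s (gtdet 0) (finfun (sbox_val l) + z)
  = \sum_(c : {ffun 'I_m -> bool}) choice_sign c *
      steps (@pair_shift m) s (gtdet 1)
        ([ffun j => if c j then hi (lift ord0 j) + 1
                    else lo (widen_ord (leqnSn m) j)] + z).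
Proof.
elim: s z => [|p s IHs] z /=; first exact: sum_sbox_gtdet.
transitivity (\sum_(a : sdarrow) (-1) ^+ neg a *
    \sum_(l : sbox lo hi) (-1) ^+ neg l * steps (@pair_shift m) s (gtdet 0)
      (finfun (sbox_val l) + (z + pair_shift p a))).
  under [RHS]eq_bigr do rewrite mulr_sumr.
  rewrite exchange_big; apply: eq_bigr => l _.
  by rewrite mulr_sumr; apply: eq_bigr => a _; rewrite mulrCA addrA.
rewrite (eq_bigr _ (fun a _ => congr1 _ (IHs (z + pair_shift p a)))).
under eq_bigr do rewrite mulr_sumr.
rewrite exchange_big; apply: eq_bigr => c _.
by rewrite mulr_sumr; apply: eq_bigr => a _; rewrite mulrCA addrA.
Qed.

(** The left-hand side is the point at which the sum over the box of an arrow row is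
    evaluated. *)
Lemma row_shift_sum m (k : 'I_m.+1 -> int) (c : {ffun 'I_m -> bool})
    (mu : AR m.+1) :
  [ffun j => if c j then k (lift ord0 j) - deltaNW (mu (lift ord0 j)) + 1
             else k (widen_ord (leqnSn m) j)
                  + deltaNE (mu (widen_ord (leqnSn m) j))]
    + [ffun j : 'I_m => j%:Z]
  = endpoints c (strict k) + \sum_p row_shift c p (mu p).
Proof.
apply/ffunP => j; rewrite !ffunE sum_ffunE.
have pick (g : 'I_m.+1 -> int) i : \sum_p (i == p)%:R * g p = g i.
  rewrite (bigD1 i) //= eqxx mul1r big1 ?addr0 // => p /negbTE.
  by rewrite eq_sym => ->; rewrite mul0r.
under eq_bigr do rewrite ffunE.
case: ifP => _; last by rewrite pick /=; lia.
by rewrite sumrN pick lift0; lia.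
Qed.

(** No entry is at once a selected upper end and a selected lower end, so each
    operator is [1 + E - E], [E^-1 + 1 - E^-1] or [1 + 1 - 1]. *)
Lemma steps_row_threshold m (i : 'I_m.+1) (f : vec m -> int) :
  steps (row_shift (threshold i)) (enum 'I_m.+1) f = f.
Proof.
apply: steps_id => p _; apply: functional_extensionality => y.
rewrite /step sum_suarrow /= expr0 expr1 !mul1r mulN1r.
have [pi|ip] := ltnP p i.
  have z (j : 'I_m) : (i <= j)%N -> (lift ord0 j == p) = false.
    by move=> ij; apply/negbTE; rewrite -val_eqE /= /bump; lia.
  have -> : y + row_shift (threshold i) p NW = y.
    by apply/ffunP => j; rewrite !ffunE; case: ifP => [/z ->|_] /=; ring.
  have -> : row_shift (threshold i) p NE = row_shift (threshold i) p UBoth.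
    by apply/ffunP => j; rewrite !ffunE; case: ifP => [/z ->|_] /=; ring.
  by ring.
have z (j : 'I_m) : (i <= j)%N = false -> (widen_ord (leqnSn m) j == p) = false.
  by move=> ij; apply/negbTE; rewrite -val_eqE /=; lia.
have -> : y + row_shift (threshold i) p NE = y.
  by apply/ffunP => j; rewrite !ffunE; case: ifP => [_|/z ->] /=; ring.
have -> : row_shift (threshold i) p NW = row_shift (threshold i) p UBoth.
  by apply/ffunP => j; rewrite !ffunE; case: ifP => [_|/z ->] /=; ring.
by ring.
Qed.

(** * Cancellation at an upper end followed by a lower end *)

Definition other_pairs m (j1 j2 : 'I_m) := [seq p <- pairs m | p != (j1, j2)].

Lemma perm_pairs_adjacent m (j1 j2 : 'I_m) : j2 = j1.+1 :> nat ->
  perm_eq (pairs m) ((j1, j2) :: other_pairs j1 j2).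
Proof.
move=> e; apply: uniq_perm; first exact: uniq_pairs.
  by rewrite /= filter_uniq ?uniq_pairs // mem_filter eqxx.
move=> p; rewrite in_cons mem_filter; case: eqP => // ->.
by rewrite mem_pairs /= e leqnn.
Qed.

(** Exchanging adjacent indices reverses the order of no pair but [(j1, j2)]. *)
Lemma perm_pairs_tperm m (j1 j2 : 'I_m) : j2 = j1.+1 :> nat ->
  perm_eq (other_pairs j1 j2)
    [seq (tperm j1 j2 p.1, tperm j1 j2 p.2) | p <- other_pairs j1 j2].
Proof.
set s := other_pairs j1 j2.
move=> e; pose t := tperm j1 j2; pose t2 (p : 'I_m * 'I_m) := (t p.1, t p.2).
have t2K : involutive t2 by move=> [a b]; rewrite /t2 /= !tpermK.
have us : uniq s by rewrite filter_uniq ?uniq_pairs.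
have ts p : p \in s -> t2 p \in s.
  case: p => a b; rewrite !mem_filter !mem_pairs /t2 !xpair_eqE /= /t.
  by do 2!case: tpermP => [->|->|/eqP + /eqP +]; rewrite -?val_eqE /=; lia.
apply: uniq_perm => //; first by rewrite map_inj_uniq //; apply: inv_inj t2K.
move=> p; apply/idP/mapP => [ps|[q qs ->]]; last exact: ts.
by exists (t2 p); rewrite ?ts // -[RHS]/(t2 (t2 p)) t2K.
Qed.

Lemma steps_pairs_tperm m (j1 j2 : 'I_m) (y : vec m) : j2 = j1.+1 :> nat ->
  let R := steps (@pair_shift m) (other_pairs j1 j2) (gtdet 1) in
  R (pull (tperm j1 j2) y) = - R y.
Proof.
move=> e R; pose s := other_pairs j1 j2.
have := @steps_pull _ _ (tperm j1 j2) s (gtdet 1) perm_inj.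
rewrite -(perm_steps _ _ (perm_pairs_tperm e)) => H.
transitivity ((R \o pull (tperm j1 j2)) y) => //.
rewrite -H -stepsN; congr (steps _ _ _ _).
apply: functional_extensionality => z; apply: gtdet_tperm.
by rewrite -val_eqE /= e; lia.
Qed.

(** The arrow contributes the translations [(-1, 0)], [(0, 1)] and, with sign -1,
    [(-1, 1)] of the coordinates [j1] and [j2]; the pair contributes [(1, 0)],
    [(0, -1)] and, with sign -1, [(1, -1)].  The signed family of the nine sums is
    invariant under exchange of the two coordinates. *)
Lemma step_row_pair m (c : {ffun 'I_m -> bool}) (j1 j2 : 'I_m) (R : vec m -> int)
    (y : vec m) :
    j2 = j1.+1 :> nat -> c j1 -> ~~ c j2 ->
    (forall z, R (pull (tperm j1 j2) z) = - R z) -> y j1 = y j2 ->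
  step (row_shift c (lift ord0 j1)) (step (pair_shift (j1, j2)) R) y = 0.
Proof.
move=> e c1 c2 Ranti y12.
have n12 : (j1 == j2) = false by apply/negbTE; rewrite -val_eqE /= e; lia.
have n21 : (j2 == j1) = false by rewrite eq_sym.
pose h (a b : int) :=
  R (y + [ffun j => (j == j1)%:R * a + (j == j2)%:R * b]).
have hC a b : h a b = - h b a.
  rewrite -Ranti; congr R; apply/ffunP => j; rewrite !ffunE.
  case: tpermP => [->|->|/eqP/negbTE -> /eqP/negbTE ->] //;
  by rewrite ?eqxx ?n12 ?n21 ?y12 /=; ring.
have hE a b : R (y + row_shift c (lift ord0 j1) a + pair_shift (j1, j2) b)
    = h (deltaSW b - deltaNW a) (deltaNE a - deltaSE b).
  congr R; apply/ffunP => j; rewrite !ffunE /=.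
  have -> : (lift ord0 j == lift ord0 j1) = (j == j1).
    by rewrite (inj_eq (@lift_inj _ ord0)).
  have -> : (widen_ord (leqnSn m) j == lift ord0 j1) = (j == j2).
    by rewrite -!val_eqE /= e.
  have [->|j1n] := eqVneq j j1; first by rewrite c1 n12 /=; ring.
  have [->|j2n] := eqVneq j j2; first by rewrite (negbTE c2) /=; ring.
  by case: ifP => _; rewrite /=; ring.
rewrite /step sum_suarrow !sum_sdarrow !hE.
rewrite -[LHS]/(1 * (1 * h 0 0 + 1 * h (-1) (-1) + -1 * h 0 (-1))
  + 1 * (1 * h 1 1 + 1 * h 0 0 + -1 * h 1 0)
  + -1 * (1 * h 0 1 + 1 * h (-1) 0 + -1 * h 0 0)).
have := hC 0 0; have := hC 1 1; have := hC (-1) (-1).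
have := hC 1 0; have := hC 0 (-1); lia.
Qed.

(** The arrows at entries other than the common one move neither of the two
    coordinates, so they preserve the set of points where these are equal. *)
Lemma steps_row_adjacent m (c : {ffun 'I_m -> bool}) (j1 j2 : 'I_m) (x : vec m.+1) :
    j2 = j1.+1 :> nat -> c j1 -> ~~ c j2 ->
  steps (row_shift c) (enum 'I_m.+1)
    (steps (@pair_shift m) (pairs m) (gtdet 1)) (endpoints c x) = 0.
Proof.
move=> e c1 c2; pose i := lift ord0 j1.
have iE : i = widen_ord (leqnSn m) j2 by apply: val_inj; rewrite /= e.
have enumE : perm_eq (enum 'I_m.+1) (rem i (enum 'I_m.+1) ++ [:: i]).
  by rewrite cats1 perm_sym perm_rcons perm_sym perm_to_rem ?mem_enum.
rewrite (perm_steps _ _ enumE) steps_cat.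
apply: (@steps_vanish _ _ _ _ (fun y : vec m => y j1 = y j2)).
- move=> p a y; rewrite (rem_filter _ (enum_uniq _)) mem_filter => /andP[pi _] y12.
  rewrite !ffunE c1 (negbTE c2) -/i -iE y12 eq_sym (negbTE pi) /=; ring.
- move=> y y12 /=; rewrite (perm_steps _ _ (perm_pairs_adjacent e)) /=.
  by apply: (step_row_pair e) => // z; apply: steps_pairs_tperm.
- by rewrite !ffunE c1 (negbTE c2) -/i iE.
Qed.

(** * The recursion *)

Lemma scard_arrow_rows (n : nat) (k : 'I_n.+2 -> int) :
  scard (sunion (fun mu : AR n.+2 =>
           sunion (fun l : e_box k mu => SGT (sbox_val l)))) = scard (SGT k).
Proof.
pose F := steps (@pair_shift n.+1) (pairs n.+1) (gtdet 1).
rewrite scard_SGT steps_gtdet_expand scard_sunion.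
transitivity (\sum_(mu : AR n.+2) (-1) ^+ neg mu *
    \sum_c choice_sign c * F (endpoints c (strict k) + \sum_p row_shift c p (mu p))).
  apply: eq_bigr => mu _; rewrite scard_sunion; congr (_ * _).
  transitivity (\sum_(l : e_box k mu) (-1) ^+ neg l *
      steps (@pair_shift n.+1) (pairs n.+1) (gtdet 0)
        (finfun (sbox_val l) + [ffun j : 'I_n.+1 => j%:Z])).
    apply: eq_bigr => l _; rewrite scard_SGT.
    by congr (_ * steps _ _ _ _); apply/ffunP => j; rewrite !ffunE.
  rewrite sum_sbox_steps; apply: eq_bigr => c _.
  by rewrite -row_shift_sum.
under eq_bigr do rewrite mulr_sumr.
rewrite exchange_big.
transitivity (\sum_c choice_sign c *
    steps (row_shift c) (enum 'I_n.+2) F (endpoints c (strict k))).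
  apply: eq_bigr => c _; rewrite -(sum_spow_steps _ _ (NW : suarrow)) mulr_sumr.
  by apply: eq_bigr => mu _; rewrite mulrCA.
rewrite sum_threshold => [|c j1 j2 e c1 c2]; last first.
  by rewrite (steps_row_adjacent _ e) ?mulr0.
apply: eq_bigr => i _.
by rewrite steps_row_threshold choice_sign_threshold endpoints_threshold.
Qed.

Theorem mainTheorem2 (n : nat) (k : 'I_n.+2 -> int) (x : int) :
  exists phi,
    @is_sijection
      (sunion (fun mu : AR n.+2 =>
         sunion (fun l : e_box k mu => SGT (sbox_val l))))
      (SGT k)
      phi.
Proof. exact/sijection_of_scard/scard_arrow_rows. Qed.
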